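(* Let $(\mathbf c^k)_{k\in\mathbb N}$, $(\tilde{\mathbf c}^k)_{k\in\mathbb N}$ be generated by any one of the six hybrid schemes MIX-I, ..., MIX-VI (listed in the context, with the stated conditions on the metrics). Let $B_1\subset\mathbb R^N$, $B_2\subset\mathbb R^{M_1}$, $B_3\subset\mathbb R^{M_2}$, $B_4\subset\mathbb R^{M_1}$ be such that $B:=B_1\times B_2\times B_3\times B_4$ is bounded. Then for every $k\ge1$ the primal-dual gap restricted to $B$ satisfies $$\Psi_{B_1\times B_2\times B_3\times B_4}\Big(\frac1k\sum_{i=0}^{k-1}\tilde{\mathbf c}^i\Big)\le\frac1{2k}\sup_{\mathbf c\in B_1\times B_2\times B_3\times B_4}\big\|\mathbf c^0-\mathbf c\big\|_{\mathcal S}^2 .$$ Furthermore, $\Psi_{B_1\times B_2\times B_3\times B_4}\big(\frac1k\sum_{i=0}^{k-1}\tilde{\mathbf c}^i\big)\ge0$ if $B$ contains a saddle point $\mathbf c^\star=(\mathbf x^\star,\mathbf a^\star,\mathbf b^\star,\mathbf p^\star)\in\mathrm{zer}\,\mathcal A$.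
   Context: Let $f:\mathbb R^N\to\mathbb R\cup\{+\infty\}$, $g:\mathbb R^{M_1}\to\mathbb R\cup\{+\infty\}$, $h:\mathbb R^{M_2}\to\mathbb R\cup\{+\infty\}$ be proper, lower semicontinuous and convex, $h^*$ the Fenchel conjugate of $h$, and $\mathbf A:\mathbb R^N\to\mathbb R^{M_1}$, $\mathbf B:\mathbb R^N\to\mathbb R^{M_2}$ linear. Let $$\mathcal L(\mathbf x,\mathbf a,\mathbf b,\mathbf p)=f(\mathbf x)+g(\mathbf a)+\langle\mathbf p,\mathbf A\mathbf x-\mathbf a\rangle+\langle\mathbf b,\mathbf B\mathbf x\rangle-h^*(\mathbf b).$$ Write $\mathbf c=(\mathbf x,\mathbf a,\mathbf b,\mathbf p)\in\mathbb R^N\times\mathbb R^{M_1}\times\mathbb R^{M_2}\times\mathbb R^{M_1}$. The primal-dual gap restricted to $B_1\times B_2\times B_3\times B_4$ is $$\Psi_{B_1\times B_2\times B_3\times B_4}(\mathbf c)=\sup_{(\mathbf b',\mathbf p')\in B_3\times B_4}\mathcal L(\mathbf x,\mathbf a,\mathbf b',\mathbf p')-\inf_{(\mathbf x',\mathbf a')\in B_1\times B_2}\mathcal L(\mathbf x',\mathbf a',\mathbf b,\mathbf p).$$ $\mathbb S_+$ (resp. $\mathbb S_{++}$): symmetric positive semidefinite (resp. definite) matrices; $X\succ Y$ means $X-Y\in\mathbb S_{++}$; $\|\mathbf c\|_{\mathcal S}^2=\langle\mathbf c,\mathcal S\mathbf c\rangle$; $\mathbf I$ is the identity. $\mathbf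 M$ ($N\times N$), $\mathbf\Omega,\mathbf\Theta$ ($M_1\times M_1$), $\mathbf\Gamma$ ($M_2\times M_2$) are symmetric (proximal metrics), with $\mathbf\Theta,\mathbf\Gamma$ invertible. Let $$\mathcal A=\begin{bmatrix}\partial f&0&\mathbf B^\top&\mathbf A^\top\\0&\partial g&0&-\mathbf I\\-\mathbf B&0&\partial h^*&0\\-\mathbf A&\mathbf I&0&0\end{bmatrix},\qquad\mathrm{zer}\,\mathcal A=\{\mathbf c:0\in\mathcal A\mathbf c\}.$$ Each scheme is a generalized proximal point algorithm $$0\in\mathcal A\tilde{\mathbf c}^k+\mathcal Q(\tilde{\mathbf c}^k-\mathbf c^k),\qquad\mathbf c^{k+1}=\mathbf c^k+\mathcal M(\tilde{\mathbf c}^k-\mathbf c^k),$$ where $\tilde{\mathbf c}^k=(\tilde{\mathbf x}^k,\tilde{\mathbf a}^k,\tilde{\mathbf b}^k,\tilde{\mathbf p}^k)$ is the proximal output; $\mathcal S=\mathcal Q\mathcal M^{-1}$, $\mathcal G=\mathcal Q+\mathcal Q^\top-\mathcal M^\top\mathcal Q$. Iterates are assumed to exist. Conditions: $\mathcal S,\mathcal G\in\mathbb S_{++}$, except for MIX-IV, where only $\mathbf M,\mathbf\Theta,\mathbf\Gamma\in\mathbb S_{++}$, $\mathbf\Omega\in\mathbb S_+$ and $\mathbf M\succ\mathbf A^\top\mathbf\Theta\mathbf A+\mathbf B^\top\mathbf\Gamma\mathbf B$ is required. Notation: $P_\varphi(B;\mathbf w)=\arg\min_{\mathbf u}\varphi(\mathbf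 u)+\frac12\langle\mathbf u,B\mathbf u\rangle-\langle\mathbf w,\mathbf u\rangle$ ($=\mathrm{prox}_\varphi^B(B^{-1}\mathbf w)$, where $\mathrm{prox}_\varphi^B(\mathbf u)=\arg\min_{\mathbf w}\varphi(\mathbf w)+\frac12\|\mathbf w-\mathbf u\|_B^2$). MIX-I: $\mathcal Q=\begin{bmatrix}\mathbf M&0&-\mathbf B^\top&-\mathbf A^\top\\0&\mathbf\Omega&0&\mathbf I\\-\mathbf B&0&\mathbf\Gamma^{-1}&0\\-\mathbf A&\mathbf I&0&\mathbf\Theta^{-1}\end{bmatrix}$, $\mathcal M=\mathbf I$; i.e. $\mathbf x^{k+1}=P_f(\mathbf M;\mathbf M\mathbf x^k-\mathbf A^\top\mathbf p^k-\mathbf B^\top\mathbf b^k)$, $\mathbf a^{k+1}=P_g(\mathbf\Omega;\mathbf\Omega\mathbf a^k+\mathbf p^k)$, $\mathbf b^{k+1}=\mathrm{prox}_{h^*}^{\mathbf\Gamma^{-1}}(\mathbf b^k+\mathbf\Gamma\mathbf B(2\mathbf x^{k+1}-\mathbf x^k))$, $\mathbf p^{k+1}=\mathbf p^k+\mathbf\Theta(\mathbf A(2\mathbf x^{k+1}-\mathbf x^k)-(2\mathbf a^{k+1}-\mathbf a^k))$. MIX-II: $\mathcal Q=\begin{bmatrix}\mathbf M&0&-\mathbf B^\top&-\mathbf A^\top\\0&\mathbf\Omega&0&-\mathbf I\\-\mathbf B&0&\mathbf\Gamma^{-1}&0\\-\mathbf A&-\mathbf I&0&\mathbf\Theta^{-1}\end{bmatrix}$,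 $\mathcal M=\mathbf I$; i.e. $\mathbf x^{k+1}=P_f(\mathbf M;\mathbf M\mathbf x^k-\mathbf B^\top\mathbf b^k-\mathbf A^\top\mathbf p^k)$, $\mathbf p^{k+1}=\mathbf p^k+\mathbf\Theta(\mathbf A(2\mathbf x^{k+1}-\mathbf x^k)-\mathbf a^k)$, $\mathbf a^{k+1}=P_g(\mathbf\Omega;\mathbf\Omega\mathbf a^k+2\mathbf p^{k+1}-\mathbf p^k)$, $\mathbf b^{k+1}=\mathrm{prox}_{h^*}^{\mathbf\Gamma^{-1}}(\mathbf b^k+\mathbf\Gamma\mathbf B(2\mathbf x^{k+1}-\mathbf x^k))$. MIX-III: $\mathcal Q=\begin{bmatrix}\mathbf M&0&-\mathbf B^\top&0\\0&\mathbf\Omega&0&-\mathbf I\\-\mathbf B&0&\mathbf\Gamma^{-1}&0\\0&-\mathbf I&0&\mathbf\Theta^{-1}\end{bmatrix}$, $\mathcal M=\mathbf I$; i.e. $\mathbf x^{k+1}=P_f(\mathbf M+\mathbf A^\top\mathbf\Theta\mathbf A;\mathbf M\mathbf x^k+\mathbf A^\top\mathbf\Theta\mathbf a^k-\mathbf B^\top\mathbf b^k-\mathbf A^\top\mathbf p^k)$, $\mathbf p^{k+1}=\mathbf p^k+\mathbf\Theta(\mathbf A\mathbf x^{k+1}-\mathbf a^k)$, $\mathbf a^{k+1}=P_g(\mathbf\Omega;\mathbf\Omega\mathbf a^k+2\mathbf p^{k+1}-\mathbf p^k)$, $\mathbf b^{k+1}=\mathrm{prox}_{h^*}^{\mathbf\Gamma^{-1}}(\mathbf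 b^k+\mathbf\Gamma\mathbf B(2\mathbf x^{k+1}-\mathbf x^k))$. MIX-IV: $\mathcal Q=\begin{bmatrix}\mathbf M&0&-\mathbf B^\top&-\mathbf A^\top\\0&\mathbf\Omega&0&0\\0&0&\mathbf\Gamma^{-1}&0\\0&0&0&\mathbf\Theta^{-1}\end{bmatrix}$, $\mathcal M=\begin{bmatrix}\mathbf I&0&0&0\\0&\mathbf I&0&0\\\mathbf\Gamma\mathbf B&0&\mathbf I&0\\\mathbf\Theta\mathbf A&0&0&\mathbf I\end{bmatrix}$; i.e. $\mathbf x^{k+1}=P_f(\mathbf M;\mathbf M\mathbf x^k-\mathbf A^\top\mathbf p^k-\mathbf B^\top\mathbf b^k)$, $\mathbf a^{k+1}=P_g(\mathbf\Omega+\mathbf\Theta;\mathbf\Omega\mathbf a^k+\mathbf p^k+\mathbf\Theta\mathbf A\mathbf x^{k+1})$, $\mathbf b^{k+1}=\mathrm{prox}_{h^*}^{\mathbf\Gamma^{-1}}(\mathbf b^k+\mathbf\Gamma\mathbf B\mathbf x^{k+1})+\mathbf\Gamma\mathbf B(\mathbf x^{k+1}-\mathbf x^k)$, $\mathbf p^{k+1}=\mathbf p^k+\mathbf\Theta(2\mathbf A\mathbf x^{k+1}-\mathbf A\mathbf x^k-\mathbf a^{k+1})$. MIX-V: $\mathcal Q=\begin{bmatrix}\mathbf M&0&-\mathbf B^\top&-\mathbf A^\top\\0&\mathbf\Omega&0&\mathbf I\\0&0&\mathbf\Gamma^{-1}&0\\0&0&0&\mathbf\Theta^{-1}\end{bmatrix}$,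 $\mathcal M=\begin{bmatrix}\mathbf I&0&0&0\\0&\mathbf I&0&0\\\mathbf\Gamma\mathbf B&0&\mathbf I&0\\\mathbf\Theta\mathbf A&-\mathbf\Theta&0&\mathbf I\end{bmatrix}$; i.e. $\mathbf x^{k+1}=P_f(\mathbf M;\mathbf M\mathbf x^k-\mathbf A^\top\mathbf p^k-\mathbf B^\top\mathbf b^k)$, $\mathbf a^{k+1}=P_g(\mathbf\Omega;\mathbf\Omega\mathbf a^k+\mathbf p^k)$, $\mathbf b^{k+1}=\mathrm{prox}_{h^*}^{\mathbf\Gamma^{-1}}(\mathbf b^k+\mathbf\Gamma\mathbf B\mathbf x^{k+1})+\mathbf\Gamma\mathbf B(\mathbf x^{k+1}-\mathbf x^k)$, $\mathbf p^{k+1}=\mathbf p^k+\mathbf\Theta(\mathbf A(2\mathbf x^{k+1}-\mathbf x^k)-(2\mathbf a^{k+1}-\mathbf a^k))$. MIX-VI: $\mathcal Q=\begin{bmatrix}\mathbf M&0&-\mathbf B^\top&0\\0&\mathbf\Omega&0&0\\-\mathbf B&0&\mathbf\Gamma^{-1}&0\\0&-\mathbf I&0&\mathbf\Theta^{-1}\end{bmatrix}$, $\mathcal M=\begin{bmatrix}\mathbf I&0&0&0\\0&\mathbf I&0&0\\0&0&\mathbf I&0\\0&-\mathbf\Theta&0&\mathbf I\end{bmatrix}$; i.e. $\mathbf x^{k+1}=P_f(\mathbf M+\mathbf A^\top\mathbf\Theta\mathbf A;\mathbf M\mathbf x^k+\mathbf A^\top\mathbf\Theta\mathbf a^k-\mathbf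 B^\top\mathbf b^k-\mathbf A^\top\mathbf p^k)$, $\mathbf a^{k+1}=P_g(\mathbf\Omega;\mathbf\Omega\mathbf a^k+\mathbf\Theta\mathbf A\mathbf x^{k+1}-\mathbf\Theta\mathbf a^k+\mathbf p^k)$, $\mathbf b^{k+1}=\mathrm{prox}_{h^*}^{\mathbf\Gamma^{-1}}(\mathbf b^k+\mathbf\Gamma\mathbf B(2\mathbf x^{k+1}-\mathbf x^k))$, $\mathbf p^{k+1}=\mathbf p^k+\mathbf\Theta(\mathbf A\mathbf x^{k+1}-\mathbf a^{k+1})$. *)

(* Defs.v *)
From HB Require Import structures.
From mathcomp Require Export all_boot all_order all_algebra.
From mathcomp Require Export all_classical all_reals all_analysis.
Export Order.TTheory GRing.Theory Num.Theory.
Export numFieldNormedType.Exports.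

Set Implicit Arguments.
Unset Strict Implicit.
Unset Printing Implicit Defensive.

#[global] Open Scope classical_set_scope.
#[global] Open Scope ring_scope.

Definition inner (R : realType) n (u v : 'cV[R]_n) : R := (u^T *m v) 0 0.

Definition norm2 (R : realType) n (S : 'M[R]_n) (u : 'cV[R]_n) : R :=
  inner u (S *m u).

Definition psdmx (R : realType) n (X : 'M[R]_n) : Prop :=
  X^T = X /\ forall u : 'cV[R]_n, 0 <= norm2 X u.

Definition pdmx (R : realType) n (X : 'M[R]_n) : Prop :=
  X^T = X /\ forall u : 'cV[R]_n, u != 0 -> 0 < norm2 X u.

Definition loewner_gt (R : realType) n (X Y : 'M[R]_n) : Prop := pdmx (X - Y).

Definition proper (R : realType) n (phi : 'cV[R]_n -> \bar R) : Prop :=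
  (forall x, phi x != -oo%E) /\ exists x, phi x != +oo%E.

(* With the library's convention [0 * +oo = 0], the cases t = 0 and t = 1 are
   harmless. *)
Definition econvex (R : realType) n (phi : 'cV[R]_n -> \bar R) : Prop :=
  forall (x y : 'cV[R]_n) (t : R), 0 <= t -> t <= 1 ->
    (phi (t *: x + (1 - t) *: y)%R
       <= t%:E * phi x + (1 - t)%R%:E * phi y)%E.

Definition proper_lsc_convex (R : realType) n (phi : 'cV[R]_n -> \bar R) :=
  [/\ proper phi, lower_semicontinuous phi & econvex phi].

Definition conjugate (R : realType) n (phi : 'cV[R]_n -> \bar R)
    (u : 'cV[R]_n) : \bar R :=
  ereal_sup [set ((inner u x)%:E - phi x)%E | x in [set: 'cV[R]_n]].

(* The subdifferential is empty outside the effective domain. *)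
Definition subdiff (R : realType) n (phi : 'cV[R]_n -> \bar R)
    (x : 'cV[R]_n) : set 'cV[R]_n :=
  [set u | phi x \is a fin_num /\
           forall y, (phi x + (inner u (y - x)%R)%:E <= phi y)%E].

(* A point c = (x, a, b, p) of R^N x R^M1 x R^M2 x R^M1 is the stacked column
   vector [vec4 x a b p]. *)
Definition vec4 (R : realType) N M1 M2 (x : 'cV[R]_N) (a : 'cV[R]_M1)
    (b : 'cV[R]_M2) (p : 'cV[R]_M1) : 'cV[R]_(N + (M1 + (M2 + M1))) :=
  col_mx x (col_mx a (col_mx b p)).

Definition xpart (R : realType) N M1 M2
    (c : 'cV[R]_(N + (M1 + (M2 + M1)))) : 'cV[R]_N :=
  usubmx c.
Definition apart (R : realType) N M1 M2
    (c : 'cV[R]_(N + (M1 + (M2 + M1)))) : 'cV[R]_M1 :=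
  usubmx (dsubmx c).
Definition bpart (R : realType) N M1 M2
    (c : 'cV[R]_(N + (M1 + (M2 + M1)))) : 'cV[R]_M2 :=
  usubmx (dsubmx (dsubmx c)).
Definition ppart (R : realType) N M1 M2
    (c : 'cV[R]_(N + (M1 + (M2 + M1)))) : 'cV[R]_M1 :=
  dsubmx (dsubmx (dsubmx c)).

Definition box (R : realType) N M1 M2 (B1 : set 'cV[R]_N) (B2 : set 'cV[R]_M1)
    (B3 : set 'cV[R]_M2) (B4 : set 'cV[R]_M1) :
    set 'cV[R]_(N + (M1 + (M2 + M1))) :=
  [set c | [/\ B1 (xpart c), B2 (apart c), B3 (bpart c) & B4 (ppart c)]].

Definition block44 (R : realType) N M1 M2
    (K11 : 'M[R]_(N, N))  (K12 : 'M[R]_(N, M1))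
    (K13 : 'M[R]_(N, M2)) (K14 : 'M[R]_(N, M1))
    (K21 : 'M[R]_(M1, N))  (K22 : 'M[R]_(M1, M1))
    (K23 : 'M[R]_(M1, M2)) (K24 : 'M[R]_(M1, M1))
    (K31 : 'M[R]_(M2, N))  (K32 : 'M[R]_(M2, M1))
    (K33 : 'M[R]_(M2, M2)) (K34 : 'M[R]_(M2, M1))
    (K41 : 'M[R]_(M1, N))  (K42 : 'M[R]_(M1, M1))
    (K43 : 'M[R]_(M1, M2)) (K44 : 'M[R]_(M1, M1)) :
    'M[R]_(N + (M1 + (M2 + M1))) :=
  col_mx (row_mx K11 (row_mx K12 (row_mx K13 K14)))
 (col_mx (row_mx K21 (row_mx K22 (row_mx K23 K24)))
 (col_mx (row_mx K31 (row_mx K32 (row_mx K33 K34)))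
         (row_mx K41 (row_mx K42 (row_mx K43 K44))))).

(* In [\bar R], [+oo - +oo = -oo].  This convention only matters when the value
   is an indeterminate form, which is excluded when [f x] and [g a] are finite,
   or when [conjugate h b] is. *)
Definition lagrangian (R : realType) N M1 M2 (f : 'cV[R]_N -> \bar R)
    (g : 'cV[R]_M1 -> \bar R) (h : 'cV[R]_M2 -> \bar R)
    (A : 'M[R]_(M1, N)) (B : 'M[R]_(M2, N))
    (x : 'cV[R]_N) (a : 'cV[R]_M1) (b : 'cV[R]_M2) (p : 'cV[R]_M1) : \bar R :=
  (f x + g a + (inner p (A *m x - a)%R)%:E + (inner b (B *m x)%R)%:E
     - conjugate h b)%E.

Definition gap (R : realType) N M1 M2 (f : 'cV[R]_N -> \bar R)
    (g : 'cV[R]_M1 -> \bar R) (h : 'cV[R]_M2 -> \bar R)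
    (A : 'M[R]_(M1, N)) (B : 'M[R]_(M2, N))
    (B1 : set 'cV[R]_N) (B2 : set 'cV[R]_M1)
    (B3 : set 'cV[R]_M2) (B4 : set 'cV[R]_M1)
    (c : 'cV[R]_(N + (M1 + (M2 + M1)))) : \bar R :=
  (ereal_sup [set lagrangian f g h A B (xpart c) (apart c) bp.1 bp.2
             | bp in B3 `*` B4]
   - ereal_inf [set lagrangian f g h A B xa.1 xa.2 (bpart c) (ppart c)
               | xa in B1 `*` B2])%E.

Definition pd_op (R : realType) N M1 M2 (f : 'cV[R]_N -> \bar R)
    (g : 'cV[R]_M1 -> \bar R) (h : 'cV[R]_M2 -> \bar R)
    (A : 'M[R]_(M1, N)) (B : 'M[R]_(M2, N))
    (c : 'cV[R]_(N + (M1 + (M2 + M1)))) : set 'cV[R]_(N + (M1 + (M2 + M1))) :=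
  [set v | exists u w z,
     [/\ subdiff f (xpart c) u, subdiff g (apart c) w,
         subdiff (conjugate h) (bpart c) z &
         v = vec4 (u + B^T *m bpart c + A^T *m ppart c)
                  (w - ppart c)
                  (- (B *m xpart c) + z)
                  (- (A *m xpart c) + apart c)]].

Definition zer (R : realType) n (T : 'cV[R]_n -> set 'cV[R]_n) : set 'cV[R]_n :=
  [set c | T c 0].

Definition generalized_ppa (R : realType) n (T : 'cV[R]_n -> set 'cV[R]_n)
    (Q K : 'M[R]_n) (c ct : nat -> 'cV[R]_n) : Prop :=
  forall k : nat,
    (exists2 v, T (ct k) v & v + Q *m (ct k - c k) = 0) /\
    c k.+1 = c k + K *m (ct k - c k).

Inductive mix_scheme : Set :=
  MIX_I | MIX_II | MIX_III | MIX_IV | MIX_V | MIX_VI.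

Definition mix_Q (R : realType) N M1 M2 (s : mix_scheme)
    (A : 'M[R]_(M1, N)) (B : 'M[R]_(M2, N)) (M : 'M[R]_N)
    (Omega Theta : 'M[R]_M1) (Gamma : 'M[R]_M2) :
    'M[R]_(N + (M1 + (M2 + M1))) :=
  match s with
  | MIX_I => block44
      M        0         (- B^T)       (- A^T)
      0        Omega     0             1%:M
      (- B)    0         (invmx Gamma) 0
      (- A)    1%:M      0             (invmx Theta)
  | MIX_II => block44
      M        0         (- B^T)       (- A^T)
      0        Omega     0             (- 1%:M)
      (- B)    0         (invmx Gamma) 0
      (- A)    (- 1%:M)  0             (invmx Theta)
  | MIX_III => block44
      M        0         (- B^T)       0
      0        Omega     0             (- 1%:M)
      (- B)    0         (invmx Gamma) 0
      0        (- 1%:M)  0             (invmx Theta)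
  | MIX_IV => block44
      M        0         (- B^T)       (- A^T)
      0        Omega     0             0
      0        0         (invmx Gamma) 0
      0        0         0             (invmx Theta)
  | MIX_V => block44
      M        0         (- B^T)       (- A^T)
      0        Omega     0             1%:M
      0        0         (invmx Gamma) 0
      0        0         0             (invmx Theta)
  | MIX_VI => block44
      M        0         (- B^T)       0
      0        Omega     0             0
      (- B)    0         (invmx Gamma) 0
      0        (- 1%:M)  0             (invmx Theta)
  end.

Definition mix_M (R : realType) N M1 M2 (s : mix_scheme)
    (A : 'M[R]_(M1, N)) (B : 'M[R]_(M2, N))
    (Theta : 'M[R]_M1) (Gamma : 'M[R]_M2) :
    'M[R]_(N + (M1 + (M2 + M1))) :=
  match s with
  | MIX_I | MIX_II | MIX_III => 1%:M
  | MIX_IV => block44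
      1%:M          0          0     0
      0             1%:M       0     0
      (Gamma *m B)  0          1%:M  0
      (Theta *m A)  0          0     1%:M
  | MIX_V => block44
      1%:M          0          0     0
      0             1%:M       0     0
      (Gamma *m B)  0          1%:M  0
      (Theta *m A)  (- Theta)  0     1%:M
  | MIX_VI => block44
      1%:M          0          0     0
      0             1%:M       0     0
      0             0          1%:M  0
      0             (- Theta)  0     1%:M
  end.

Definition mix_S (R : realType) N M1 M2 (s : mix_scheme)
    (A : 'M[R]_(M1, N)) (B : 'M[R]_(M2, N)) (M : 'M[R]_N)
    (Omega Theta : 'M[R]_M1) (Gamma : 'M[R]_M2) :
    'M[R]_(N + (M1 + (M2 + M1))) :=
  mix_Q s A B M Omega Theta Gamma *m invmx (mix_M s A B Theta Gamma).

Definition mix_G (R : realType) N M1 M2 (s : mix_scheme)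
    (A : 'M[R]_(M1, N)) (B : 'M[R]_(M2, N)) (M : 'M[R]_N)
    (Omega Theta : 'M[R]_M1) (Gamma : 'M[R]_M2) :
    'M[R]_(N + (M1 + (M2 + M1))) :=
  let Q := mix_Q s A B M Omega Theta Gamma in
  Q + Q^T - (mix_M s A B Theta Gamma)^T *m Q.

Definition mix_condition (R : realType) N M1 M2 (s : mix_scheme)
    (A : 'M[R]_(M1, N)) (B : 'M[R]_(M2, N)) (M : 'M[R]_N)
    (Omega Theta : 'M[R]_M1) (Gamma : 'M[R]_M2) : Prop :=
  match s with
  | MIX_IV => [/\ pdmx M, pdmx Theta, pdmx Gamma, psdmx Omega &
                  loewner_gt M (A^T *m Theta *m A + B^T *m Gamma *m B)]
  | _ => pdmx (mix_S s A B M Omega Theta Gamma) /\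
         pdmx (mix_G s A B M Omega Theta Gamma)
  end.

(* Main.v *)
Require Import Defs.
From mathcomp Require Import ring lra.

Set Implicit Arguments.
Unset Strict Implicit.
Unset Printing Implicit Defensive.

(* If v is in A(c~) then monotonicity bounds the difference of Lagrangians
   L(x~, a~, b', p') - L(x', a', b~, p~) by <v, c~ - c'>, the bilinear coupling
   being skew.  For v = - Q (c~^k - c^k), the identity Q = S K (where K is the
   relaxation matrix written M in the paper) and Q + Q^T - K^T Q >= 0 give
   <v, c~^k - c'> <= (|c^k - c'|_S^2 - |c^(k+1) - c'|_S^2) / 2,
   which telescopes.  Convexity (Jensen) moves the average inside L, and the
   supremum over c' yields the rate.  At a saddle point v = 0, which gives the
   lower bound. *)

(** * Inner products and stacked vectors *)

Section Inner.
Context {R : realType}.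

Lemma innerC n (u v : 'cV[R]_n) : inner u v = inner v u.
Proof. by rewrite /inner !mxE; apply: eq_bigr => i _; rewrite !mxE mulrC. Qed.

Lemma innerDr n (u v w : 'cV[R]_n) : inner u (v + w) = inner u v + inner u w.
Proof. by rewrite /inner mulmxDr mxE. Qed.

Lemma innerNr n (u v : 'cV[R]_n) : inner u (- v) = - inner u v.
Proof. by rewrite /inner mulmxN mxE. Qed.

Lemma innerZr n a (u v : 'cV[R]_n) : inner u (a *: v) = a * inner u v.
Proof. by rewrite /inner -scalemxAr mxE. Qed.

Lemma inner_sumr n (I : Type) (r : seq I) u (v : I -> 'cV[R]_n) :
  inner u (\sum_(i <- r) v i) = \sum_(i <- r) inner u (v i).
Proof. by rewrite /inner mulmx_sumr summxE. Qed.

Lemma innerDl n (u v w : 'cV[R]_n) : inner (u + v) w = inner u w + inner v w.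
Proof. by rewrite innerC innerDr !(innerC w). Qed.

Lemma innerNl n (u v : 'cV[R]_n) : inner (- u) v = - inner u v.
Proof. by rewrite innerC innerNr (innerC v). Qed.

Lemma inner0l n (v : 'cV[R]_n) : inner 0 v = 0.
Proof. by rewrite /inner trmx0 mul0mx mxE. Qed.

Lemma inner_trl m n (A : 'M[R]_(m, n)) u v :
  inner (A^T *m u) v = inner u (A *m v).
Proof. by rewrite /inner trmx_mul trmxK mulmxA. Qed.

Lemma inner_sym n (X : 'M[R]_n) u v :
  X^T = X -> inner u (X *m v) = inner v (X *m u).
Proof. by move=> Xsym; rewrite -inner_trl Xsym innerC. Qed.

Lemma inner_mul_inv n (X : 'M[R]_n) u v : X^T = X -> X \in unitmx ->
  inner (X *m u) (invmx X *m v) = inner u v.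
Proof. by move=> Xsym Xu; rewrite -{1}Xsym inner_trl mulKVmx. Qed.

Lemma inner_vec4 N M1 M2 (x x' : 'cV[R]_N) (a a' : 'cV[R]_M1)
    (b b' : 'cV[R]_M2) (p p' : 'cV[R]_M1) :
  inner (vec4 x a b p) (vec4 x' a' b' p')
    = inner x x' + inner a a' + inner b b' + inner p p'.
Proof.
by rewrite /inner /vec4 !tr_col_mx !mul_row_col !mxE !addrA.
Qed.

Lemma vec4_eta N M1 M2 (c : 'cV[R]_(N + (M1 + (M2 + M1)))) :
  vec4 (xpart c) (apart c) (bpart c) (ppart c) = c.
Proof. by rewrite /vec4 /xpart /apart /bpart /ppart !vsubmxK. Qed.

Lemma vec4_sub N M1 M2 (x x' : 'cV[R]_N) (a a' : 'cV[R]_M1)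
    (b b' : 'cV[R]_M2) (p p' : 'cV[R]_M1) :
  vec4 x a b p - vec4 x' a' b' p' = vec4 (x - x') (a - a') (b - b') (p - p').
Proof. by rewrite /vec4 !(opp_col_mx, add_col_mx). Qed.

Lemma xpart_vec4 N M1 M2 (x : 'cV[R]_N) (a : 'cV[R]_M1) (b : 'cV[R]_M2)
    (p : 'cV[R]_M1) : xpart (vec4 x a b p) = x.
Proof. by rewrite /xpart col_mxKu. Qed.

Lemma apart_vec4 N M1 M2 (x : 'cV[R]_N) (a : 'cV[R]_M1) (b : 'cV[R]_M2)
    (p : 'cV[R]_M1) : apart (vec4 x a b p) = a.
Proof. by rewrite /apart col_mxKd col_mxKu. Qed.

Lemma bpart_vec4 N M1 M2 (x : 'cV[R]_N) (a : 'cV[R]_M1) (b : 'cV[R]_M2)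
    (p : 'cV[R]_M1) : bpart (vec4 x a b p) = b.
Proof. by rewrite /bpart !col_mxKd col_mxKu. Qed.

Lemma ppart_vec4 N M1 M2 (x : 'cV[R]_N) (a : 'cV[R]_M1) (b : 'cV[R]_M2)
    (p : 'cV[R]_M1) : ppart (vec4 x a b p) = p.
Proof. by rewrite /ppart !col_mxKd. Qed.

Definition parts_vec4 := (xpart_vec4, apart_vec4, bpart_vec4, ppart_vec4).

Lemma mul_block44_vec4 N M1 M2
    (K11 : 'M[R]_(N, N))  (K12 : 'M[R]_(N, M1))
    (K13 : 'M[R]_(N, M2)) (K14 : 'M[R]_(N, M1))
    (K21 : 'M[R]_(M1, N))  (K22 : 'M[R]_(M1, M1))
    (K23 : 'M[R]_(M1, M2)) (K24 : 'M[R]_(M1, M1))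
    (K31 : 'M[R]_(M2, N))  (K32 : 'M[R]_(M2, M1))
    (K33 : 'M[R]_(M2, M2)) (K34 : 'M[R]_(M2, M1))
    (K41 : 'M[R]_(M1, N))  (K42 : 'M[R]_(M1, M1))
    (K43 : 'M[R]_(M1, M2)) (K44 : 'M[R]_(M1, M1)) x a b p :
  block44 K11 K12 K13 K14 K21 K22 K23 K24 K31 K32 K33 K34 K41 K42 K43 K44
    *m vec4 x a b p
  = vec4 (K11 *m x + K12 *m a + K13 *m b + K14 *m p)
         (K21 *m x + K22 *m a + K23 *m b + K24 *m p)
         (K31 *m x + K32 *m a + K33 *m b + K34 *m p)
         (K41 *m x + K42 *m a + K43 *m b + K44 *m p).
Proof. by rewrite /block44 /vec4 !mul_col_mx !mul_row_col !addrA. Qed.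

End Inner.

(** * Averages and Jensen's inequality *)

Section Averages.
Context {R : realType}.

(** Weighs the newest term against the previous average, so that Jensen follows by induction from
    two-point convexity. *)
Lemma averageS (V : lmodType R) (x : nat -> V) k :
  k.+2%:R^-1 *: (\sum_(i < k.+2) x i)
  = k.+2%:R^-1 *: x k.+1
    + (1 - k.+2%:R^-1) *: (k.+1%:R^-1 *: (\sum_(i < k.+1) x i)).
Proof.
rewrite big_ord_recr /= scalerDr addrC; congr (_ + _).
rewrite scalerA; congr (_ *: _); field.
by rewrite nat1r -natrD !pnatr_eq0.
Qed.

Lemma econvex_average_le n (phi : 'cV[R]_n -> \bar R) (x : nat -> 'cV[R]_n)
    (r : nat -> R) k : econvex phi -> (forall i, phi (x i) <= (r i)%:E)%E ->
  (phi (k.+1%:R^-1 *: \sum_(i < k.+1) x i)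
     <= (k.+1%:R^-1 * \sum_(i < k.+1) r i)%:E)%E.
Proof.
move=> cphi le_r; elim: k => [|k IHk].
  by rewrite !big_ord1 invr1 scale1r mul1r.
have -> : k.+2%:R^-1 * \sum_(i < k.+2) r i
    = k.+2%:R^-1 * r k.+1
      + (1 - k.+2%:R^-1) * (k.+1%:R^-1 * (\sum_(i < k.+1) r i)).
  exact: (averageS (V := R^o)).
have t0 : 0 <= k.+2%:R^-1 :> R by rewrite invr_ge0 ler0n.
have t1 : k.+2%:R^-1 <= 1 :> R by rewrite invf_le1 ?ltr0n // ler1n.
rewrite averageS; apply: (le_trans (cphi _ _ _ t0 t1)).
rewrite [leRHS]EFinD !EFinM; apply: leeD; apply: lee_wpmul2l => //.
by rewrite lee_fin subr_ge0.
Qed.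

(** For each fixed y, [inner b y - h y] is affine in b, so the bounds average termwise before the
    supremum over y is taken. *)
Lemma conjugate_average_le n (h : 'cV[R]_n -> \bar R) (b : nat -> 'cV[R]_n)
    (r : nat -> R) k : proper h ->
    (forall i, conjugate h (b i) <= (r i)%:E)%E ->
  (conjugate h (k.+1%:R^-1 *: \sum_(i < k.+1) b i)
     <= (k.+1%:R^-1 * \sum_(i < k.+1) r i)%:E)%E.
Proof.
move=> [hNy _] le_r; apply: ge_ereal_sup => _ [y _ <-].
have {}le_r i : ((inner (b i) y)%:E - h y <= (r i)%:E)%E.
  by apply: le_trans (le_r i); apply: ereal_sup_ubound; exists y.
case hy : (h y) le_r (hNy y) => [s| |] // le_r _; last by rewrite leNye.
rewrite -EFinB lee_fin innerC innerZr inner_sumr.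
have -> : s = k.+1%:R^-1 * \sum_(i < k.+1) s.
  by rewrite sumr_const card_ord -[s *+ _]mulr_natl mulKf ?pnatr_eq0.
rewrite -mulrBr -sumrB ler_wpM2l ?invr_ge0 ?ler0n //; apply: ler_sum => i _.
by have := le_r i; rewrite -EFinB lee_fin innerC.
Qed.

Lemma conjugate_gtNy n (h : 'cV[R]_n -> \bar R) b :
  proper h -> (-oo < conjugate h b)%E.
Proof.
move=> [hNy [x hx]].
apply: (@lt_le_trans _ _ ((inner b x)%:E - h x)%E).
  by case: (h x) (hNy x) hx => [s| |] // _ _; rewrite -EFinB ltNyr.
by apply: ereal_sup_ubound; exists x.
Qed.

End Averages.

(** * Positive definite forms *)

Section PosDef.
Context {R : realType}.

Lemma pdmx_ge0 n (X : 'M[R]_n) u : pdmx X -> 0 <= norm2 X u.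
Proof.
move=> [_ Xpos]; have [->|/Xpos/ltW//] := eqVneq u 0.
by rewrite /norm2 inner0l.
Qed.

Lemma pdmx_inv_ge0 n (X : 'M[R]_n) u :
  X \in unitmx -> pdmx X -> 0 <= inner u (invmx X *m u).
Proof.
move=> Xu Xpd; have := pdmx_ge0 (invmx X *m u) Xpd.
by rewrite /norm2 mulKVmx // innerC.
Qed.

(** Young's inequality: expand the nonnegative X-form at [invmx X *m v - u]. *)
Lemma pdmx_young n (X : 'M[R]_n) u v : X \in unitmx -> pdmx X ->
  2 * inner u v <= inner u (X *m u) + inner v (invmx X *m v).
Proof.
move=> Xu Xpd; have := pdmx_ge0 (invmx X *m v - u) Xpd.
rewrite /norm2 mulmxBr mulKVmx // !(innerDl, innerDr, innerNl, innerNr).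
rewrite (innerC (invmx X *m v) (X *m u)) inner_mul_inv ?Xpd.1 //.
rewrite (innerC (invmx X *m v) v); lra.
Qed.

End PosDef.

(** * Descent of the generalized proximal point iteration *)

(* With [S := Q *m invmx K], the last three clauses say that S is symmetric,
   S >= 0 and Q + Q^T - K^T Q >= 0.  They are stated on the range of K so that
   neither S nor a transpose of Q has to be computed. *)
Definition ppa_admissible (R : realType) n (Q K : 'M[R]_n) : Prop :=
  [/\ K \in unitmx,
      forall u v, inner (K *m u) (Q *m v) = inner (Q *m u) (K *m v),
      forall u, 0 <= inner (K *m u) (Q *m u) &
      forall u, inner (K *m u) (Q *m u) <= 2 * inner u (Q *m u)].

Section PPA.
Context {R : realType}.

Lemma norm2_admissible n (Q K : 'M[R]_n) u :
  K \in unitmx -> norm2 (Q *m invmx K) (K *m u) = inner (K *m u) (Q *m u).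
Proof. by move=> Ku; rewrite /norm2 mulmxA mulmxKV. Qed.

Lemma norm2_admissible_ge0 n (Q K : 'M[R]_n) u :
  ppa_admissible Q K -> 0 <= norm2 (Q *m invmx K) u.
Proof.
by case=> Ku _ ge0 _; rewrite -(mulKVmx Ku u) norm2_admissible.
Qed.

Lemma ppa_descent n (Q K : 'M[R]_n) (c ct c' : 'cV[R]_n) :
  ppa_admissible Q K ->
  inner (Q *m (ct - c)) (c' - ct) <=
  2^-1 * (norm2 (Q *m invmx K) (c - c')
          - norm2 (Q *m invmx K) (c + K *m (ct - c) - c')).
Proof.
(* The errors before and after the step are K u and K (u + d), so both norms expand without
   inverses. Symmetry merges the cross terms, and what remains is exactly [le2 d]. *)
case=> Ku sym _ le2; set d := ct - c; set u := invmx K *m (c - c').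
have ccE : c - c' = K *m u by rewrite mulKVmx.
have -> : c + K *m d - c' = K *m (u + d) by rewrite [RHS]mulmxDr -ccE addrAC.
have -> : c' - ct = - (K *m u) - d by rewrite -ccE /d !opprB addrA subrK.
rewrite ccE !norm2_admissible //; move: (u) (d) => {ccE}{}u {}d.
rewrite !mulmxDr !(innerDl, innerDr, innerNr).
have := le2 d; have := sym d u.
rewrite (innerC (K *m u) (Q *m d)) (innerC d).
lra.
Qed.

Lemma ppa_sum_le n (T : 'cV[R]_n -> set 'cV[R]_n) (Q K : 'M[R]_n)
    (c ct : nat -> 'cV[R]_n) c' k (ell : 'cV[R]_n -> R) :
  ppa_admissible Q K -> generalized_ppa T Q K c ct ->
  (forall x v, T x v -> ell x <= inner v (x - c')) ->
  \sum_(i < k) ell (ct i) <= 2^-1 * norm2 (Q *m invmx K) (c 0%N - c').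
Proof.
move=> adm ppa le_ell; set S := Q *m invmx K.
(* Keeping the last distance makes the bound telescope by induction; its nonnegativity then removes
   it. *)
suff : \sum_(i < k) ell (ct i)
    <= 2^-1 * (norm2 S (c 0%N - c') - norm2 S (c k - c')).
  by have := norm2_admissible_ge0 (c k - c') adm; rewrite -/S; lra.
elim: k => [|k IHk]; first by rewrite big_ord0 subrr mulr0.
rewrite big_ord_recr /=.
have [[v Tv v0] ckS] := ppa k.
have := ppa_descent (c k) (ct k) c' adm; rewrite -ckS -/S.
have := le_ell _ _ Tv.
have -> : v = - (Q *m (ct k - c k)) by apply/eqP; rewrite -addr_eq0 v0.
rewrite innerNl -innerNr opprB; lra.
Qed.

(** Writing Q = S K turns symmetry and positivity of S into the second and third clauses; the fourth
    comes from <u, G u> = 2 <u, Q u> - <K u, Q u>. *)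
Lemma ppa_admissible_pd n (Q K : 'M[R]_n) : K \in unitmx ->
  pdmx (Q *m invmx K) -> pdmx (Q + Q^T - K^T *m Q) -> ppa_admissible Q K.
Proof.
move=> Ku Spd Gpd.
have QE : Q = Q *m invmx K *m K by rewrite mulmxKV.
split=> // [u v|u|u].
- by rewrite QE -!(mulmxA _ K) -inner_trl Spd.1.
- by rewrite -norm2_admissible // pdmx_ge0.
- have := pdmx_ge0 u Gpd.
  rewrite /norm2 !mulmxDl mulNmx !innerDr innerNr -mulmxA.
  rewrite (innerC u (Q^T *m u)) inner_trl (innerC u (K^T *m _)) inner_trl.
  by rewrite (innerC (Q *m u) (K *m u)); lra.
Qed.

End PPA.

(** * Admissibility of the six schemes *)

Section Mix.
Context {R : realType} {N M1 M2 : nat}.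
Implicit Types (A : 'M[R]_(M1, N)) (B : 'M[R]_(M2, N)).

(** The rows of [kermx K^T], once transposed, are vectors killed by K. *)
Lemma unitmx_inj n (K : 'M[R]_n) :
  (forall u : 'cV_n, K *m u = 0 -> u = 0) -> K \in unitmx.
Proof.
move=> inj; rewrite -unitmx_tr -row_free_unit -kermx_eq0.
apply/eqP/row_matrixP => i; rewrite row0.
have : row i (kermx K^T) *m K^T = 0 by rewrite -row_mul mulmx_ker row0.
move/(congr1 trmx); rewrite trmx_mul trmxK trmx0 => /inj/(congr1 trmx).
by rewrite trmxK trmx0.
Qed.

Lemma vec4_eq0 (x : 'cV[R]_N) (a : 'cV[R]_M1) (b : 'cV[R]_M2) (p : 'cV[R]_M1) :
  vec4 x a b p = 0 -> [/\ x = 0, a = 0, b = 0 & p = 0].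
Proof.
move=> /eqP; rewrite /vec4 !col_mx_eq0.
by case/and4P=> /eqP-> /eqP-> /eqP-> /eqP->.
Qed.

(** The matrix is block lower triangular with unit diagonal and preserves x and a: a kernel vector
    has x = a = 0, and then b = p = 0. *)
Lemma mix_M_unit s A B (Theta : 'M[R]_M1) (Gamma : 'M[R]_M2) :
  mix_M s A B Theta Gamma \in unitmx.
Proof.
case: s; rewrite /= ?unitmx1 //; apply: unitmx_inj => u;
  rewrite -[u]vec4_eta mul_block44_vec4 !(mul0mx, mul1mx, addr0, add0r);
  move=> /vec4_eq0[-> ->]; rewrite !(mulmx0, addr0, add0r) => -> ->;
  by rewrite /vec4 !col_mx0.
Qed.

Lemma mix_admissible s A B (M : 'M[R]_N) (Omega Theta : 'M[R]_M1)
    (Gamma : 'M[R]_M2) :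
  M^T = M -> Omega^T = Omega -> Theta \in unitmx -> Gamma \in unitmx ->
  mix_condition s A B M Omega Theta Gamma ->
  ppa_admissible (mix_Q s A B M Omega Theta Gamma) (mix_M s A B Theta Gamma).
Proof.
move=> Msym Osym Tu Gu cond.
have := mix_M_unit s A B Theta Gamma.
case: s cond => /= cond Ku; try by case: cond => *; apply: ppa_admissible_pd.
(* MIX-IV: here [K^T *m Q] is block diagonal, see [KQ] below. *)
case: cond => Mpd Tpd Gpd [_ Opsd] Mgt.
set Q := block44 _ _ _ _ _ _ _ _ _ _ _ _ _ _ _ _.
set K := block44 _ _ _ _ _ _ _ _ _ _ _ _ _ _ _ _ in Ku *.
have QE x a b p : Q *m vec4 x a b p = vec4 (M *m x - B^T *m b - A^T *m p)
    (Omega *m a) (invmx Gamma *m b) (invmx Theta *m p).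
  by rewrite mul_block44_vec4 !(mul0mx, addr0, add0r, mulNmx).
have KE x a b p : K *m vec4 x a b p
    = vec4 x a (Gamma *m (B *m x) + b) (Theta *m (A *m x) + p).
  by rewrite mul_block44_vec4 !(mul0mx, mul1mx, addr0, add0r, mulmxA).
(* The term [- B^T b'] in the first row of Q cancels against [Gamma B x] paired with
   [invmx Gamma b']; likewise for A and Theta. *)
have KQ x a b p x' a' b' p' :
    inner (K *m vec4 x a b p) (Q *m vec4 x' a' b' p')
    = inner x (M *m x') + inner a (Omega *m a')
      + inner b (invmx Gamma *m b') + inner p (invmx Theta *m p').
  rewrite QE KE inner_vec4 !(innerDl, innerDr, innerNr).
  rewrite !inner_mul_inv ?Gpd.1 ?Tpd.1 // -!inner_trl !trmxK.
  rewrite !(inner_trl, innerC (_ *m x)); lra.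
split=> // [u v|u|u]; rewrite -[u]vec4_eta;
  move: (xpart u) (apart u) (bpart u) (ppart u) => x a b p.
- rewrite -[v]vec4_eta KQ [RHS]innerC KQ.
  by congr (_ + _ + _ + _); apply: inner_sym; rewrite ?trmx_inv ?Gpd.1 ?Tpd.1.
- by rewrite KQ !addr_ge0 ?pdmx_inv_ge0 //; [exact: pdmx_ge0 | exact: Opsd].
(* Here 2 <u, Q u> - <K u, Q u> is the block diagonal form minus 2 <B x, b> and 2 <A x, p>. Young
   with Gamma and Theta bounds these two terms, and the Loewner condition on M absorbs what remains
   in x. *)
- have := pdmx_ge0 x Mgt; have := Opsd a.
  have := pdmx_young (B *m x) b Gu Gpd; have := pdmx_young (A *m x) p Tu Tpd.
  rewrite KQ QE inner_vec4 /norm2 !(mulmxBl, mulmxDl) -!mulmxA.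
  rewrite !(innerDr, innerNr) !(innerC x (_^T *m _)) !inner_trl.
  rewrite !(innerC (_ *m x)); lra.
Qed.
End Mix.

(** * The Lagrangian and its bilinear coupling *)

Section Gap.
Context {R : realType} {N M1 M2 : nat}.
Context (f : 'cV[R]_N -> \bar R) (g : 'cV[R]_M1 -> \bar R)
  (h : 'cV[R]_M2 -> \bar R) (A : 'M[R]_(M1, N)) (B : 'M[R]_(M2, N)).

(** The real-valued part of the Lagrangian, isolated because it averages exactly in each of (x, a)
    and (b, p). *)
Definition coupling (x : 'cV[R]_N) (a : 'cV[R]_M1) (b : 'cV[R]_M2)
    (p : 'cV[R]_M1) : R :=
  inner p (A *m x - a) + inner b (B *m x).

Lemma pd_op_fin c v : pd_op f g h A B c v ->
  [/\ f (xpart c) \is a fin_num, g (apart c) \is a fin_num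
    & conjugate h (bpart c) \is a fin_num].
Proof. by move=> [u [w [z [[? _] [? _] [? _] _]]]]; split. Qed.

(** The left side is L(x, a, b', p') - L(x', a', b, p) written in [R]. The three subgradient
    inequalities are added; the skew linear part of v, paired with c - c', gives exactly the
    difference of couplings. *)
Lemma pd_op_monotone_gap c v c' (phi gamma eta : R) :
  pd_op f g h A B c v -> f (xpart c') = phi%:E -> g (apart c') = gamma%:E ->
  conjugate h (bpart c') = eta%:E ->
  fine (f (xpart c)) + fine (g (apart c))
    + coupling (xpart c) (apart c) (bpart c') (ppart c') - eta
  - (phi + gamma + coupling (xpart c') (apart c') (bpart c) (ppart c)
       - fine (conjugate h (bpart c)))
  <= inner v (c - c').
Proof.
move=> [u [w [z [[fc uP] [gc wP] [hc zP] ->]]]] fE gE hE.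
have := uP (xpart c'); have := wP (apart c'); have := zP (bpart c').
rewrite fE gE hE -{1}(fineK fc) -{1}(fineK gc) -{1}(fineK hc) -!EFinD !lee_fin.
have -> : c - c' = vec4 (xpart c - xpart c') (apart c - apart c')
    (bpart c - bpart c') (ppart c - ppart c').
  by rewrite -vec4_sub !vec4_eta.
rewrite inner_vec4.
move: (xpart c) (apart c) (bpart c) (ppart c) => x a b p in fc gc hc *.
move: (xpart c') (apart c') (bpart c') (ppart c') => x' a' b' p'.
rewrite /coupling.
rewrite !(innerDl, innerNl, innerDr, innerNr) !inner_trl.
rewrite !(innerC (A *m _)) !(innerC (B *m _)) !(innerC a).
lra.
Qed.

(** Convexity gives only upper bounds at an averaged primal point, while the dual argument is a test
    point with known conjugate. *)
Lemma lagrangian_le_fin x a b p (phi gamma eta : R) :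
  (f x <= phi%:E)%E -> (g a <= gamma%:E)%E -> conjugate h b = eta%:E ->
  (lagrangian f g h A B x a b p <= (phi + gamma + coupling x a b p - eta)%:E)%E.
Proof.
move=> fx ga hb; rewrite /lagrangian hb /coupling addrA EFinB leeD //.
by rewrite !EFinD !leeD.
Qed.

(** Mirror case: at an averaged dual point only an upper bound on the conjugate is known, and it
    enters negatively. *)
Lemma lagrangian_ge_fin x a b p (phi gamma eta : R) :
  f x = phi%:E -> g a = gamma%:E -> (conjugate h b <= eta%:E)%E ->
  ((phi + gamma + coupling x a b p - eta)%:E <= lagrangian f g h A B x a b p)%E.
Proof.
move=> fx ga hb; rewrite /lagrangian fx ga -!EFinD EFinB /coupling addrA.
by rewrite leeD // leeN2.
Qed.

Lemma lagrangian_conjugate_pinfty x a b p :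
  conjugate h b = +oo%E -> lagrangian f g h A B x a b p = -oo%E.
Proof. by rewrite /lagrangian => ->; rewrite addeNy. Qed.

Lemma coupling_averagel (x : nat -> 'cV[R]_N) (a : nat -> 'cV[R]_M1) b p k :
  coupling (k%:R^-1 *: \sum_(i < k) x i) (k%:R^-1 *: \sum_(i < k) a i) b p
  = k%:R^-1 * \sum_(i < k) coupling (x i) (a i) b p.
Proof.
rewrite /coupling -!scalemxAr -scalerBr !innerZr -mulrDr.
by rewrite !mulmx_sumr -sumrB !inner_sumr -big_split.
Qed.

Lemma coupling_averager x a (b : nat -> 'cV[R]_M2) (p : nat -> 'cV[R]_M1) k :
  coupling x a (k%:R^-1 *: \sum_(i < k) b i) (k%:R^-1 *: \sum_(i < k) p i)
  = k%:R^-1 * \sum_(i < k) coupling x a (b i) (p i).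
Proof.
rewrite /coupling !(innerC (_ *: _)) !innerZr -mulrDr !inner_sumr -big_split /=.
congr (_ * _); apply: eq_bigr => i _.
by rewrite !(innerC _ (A *m x - a)) !(innerC _ (B *m x)).
Qed.

End Gap.

(** * Supremum minus infimum in the extended reals *)

(* Valid also when X or Y is empty, since [-oo] absorbs [+oo] in [\bar R]. *)
Lemma ereal_sup_sub_inf_le (R : realType) (X Y : set (\bar R)) C :
  (forall u v, X u -> Y v -> u <= C + v)%E ->
  (ereal_sup X - ereal_inf Y <= C)%E.
Proof.
move=> le_uv; case: C le_uv => [C| |] le_uv; last 2 first.
- by rewrite leey.
- have [->|/set0P[v Yv]] := eqVneq Y set0; first by rewrite ereal_inf0 addeNy.
  suff -> : ereal_sup X = -oo%E by rewrite addNye.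
  by apply/eqP; rewrite -leeNy_eq; apply: ge_ereal_sup => u /le_uv/(_ Yv).
have : (ereal_sup X <= C%:E + ereal_inf Y)%E.
  apply: ge_ereal_sup => u Xu; rewrite addeC -leeBlDr //.
  by apply: le_ereal_inf_tmp => v Yv; rewrite leeBlDr // addeC le_uv.
case: (ereal_inf Y) => [i| |].
- by rewrite leeBlDr.
- by rewrite addeNy leNye.
- by rewrite addeNy leeNy_eq => /eqP ->; rewrite addNye leNye.
Qed.

(** The two strict bounds rule out the indeterminate differences, whose conventional value is
    [-oo]. *)
Lemma ereal_sup_sub_inf_ge0 (R : realType) (X Y : set (\bar R)) u v :
  X u -> Y v -> (-oo < u)%E -> (v < +oo)%E -> (v <= u)%E ->
  (0 <= ereal_sup X - ereal_inf Y)%E.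
Proof.
move=> /ereal_sup_ubound uX /ereal_inf_lbound vY uNy vy vu.
move: (lt_le_trans uNy uX) (le_lt_trans vY vy) (le_trans vY (le_trans vu uX)).
case: (ereal_sup X) (ereal_inf Y) => [s| |] [i| |] //= _ _; rewrite ?leey //.
by rewrite lee_fin -EFinB lee_fin subr_ge0.
Qed.

(** * Pointwise Lagrangian bounds for the average and at a saddle point *)

Section Rate.
Context {R : realType} {N M1 M2 : nat}.
Context (f : 'cV[R]_N -> \bar R) (g : 'cV[R]_M1 -> \bar R)
  (h : 'cV[R]_M2 -> \bar R) (A : 'M[R]_(M1, N)) (B : 'M[R]_(M2, N)).

(** One Lagrangian is moved to the right so that no difference of infinities appears; this is the
    form required by [ereal_sup_sub_inf_le]. *)
Lemma lagrangian_sub_average_le (Q K : 'M[R]_(N + (M1 + (M2 + M1)))) c ct c'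
    k avg :
  proper_lsc_convex f -> proper_lsc_convex g -> proper_lsc_convex h ->
  ppa_admissible Q K -> generalized_ppa (pd_op f g h A B) Q K c ct ->
  avg = k.+1%:R^-1 *: \sum_(i < k.+1) ct i ->
  (lagrangian f g h A B (xpart avg) (apart avg) (bpart c') (ppart c')
   <= ((2 * k.+1%:R)^-1 * norm2 (Q *m invmx K) (c 0%N - c'))%:E
      + lagrangian f g h A B (xpart c') (apart c') (bpart avg) (ppart avg))%E.
Proof.
move=> [[fNy _] _ fcvx] [[gNy _] _ gcvx] [hp _ _] adm ppa avgE.
have fin i : [/\ f (xpart (ct i)) \is a fin_num, g (apart (ct i)) \is a fin_num
    & conjugate h (bpart (ct i)) \is a fin_num].
  by have [[v /pd_op_fin]] := ppa i.
have avgx : xpart avg = k.+1%:R^-1 *: \sum_(i < k.+1) xpart (ct i).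
  by rewrite avgE /xpart linearZ linear_sum.
have avga : apart avg = k.+1%:R^-1 *: \sum_(i < k.+1) apart (ct i).
  by rewrite avgE /apart !linearZ /= !linear_sum.
have avgb : bpart avg = k.+1%:R^-1 *: \sum_(i < k.+1) bpart (ct i).
  by rewrite avgE /bpart !linearZ /= !linear_sum.
have avgp : ppart avg = k.+1%:R^-1 *: \sum_(i < k.+1) ppart (ct i).
  by rewrite avgE /ppart !linearZ /= !linear_sum.
pose F i := fine (f (xpart (ct i))); pose G i := fine (g (apart (ct i))).
pose H i := fine (conjugate h (bpart (ct i))).
have favg : (f (xpart avg) <= (k.+1%:R^-1 * \sum_(i < k.+1) F i)%:E)%E.
  by rewrite avgx; apply: (econvex_average_le (x := fun i => xpart (ct i))
    (r := F)) => // i;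
    case: (fin i) => ? _ _; rewrite fineK.
have gavg : (g (apart avg) <= (k.+1%:R^-1 * \sum_(i < k.+1) G i)%:E)%E.
  by rewrite avga; apply: (econvex_average_le (x := fun i => apart (ct i))
    (r := G)) => // i;
    case: (fin i) => _ ? _; rewrite fineK.
have havg : (conjugate h (bpart avg)
    <= (k.+1%:R^-1 * \sum_(i < k.+1) H i)%:E)%E.
  by rewrite avgb; apply: (conjugate_average_le (b := fun i => bpart (ct i))
    (r := H)) => // i;
    case: (fin i) => _ _ ?; rewrite fineK.
(* Test points outside the domains are trivial: an infinite conjugate makes the left side [-oo], and
   an infinite [f] or [g] makes the right side [+oo] thanks to [havgNy]. *)
case hE : (conjugate h (bpart c')) (conjugate_gtNy (bpart c') hp)
  => [eta| |] // _;
  last by rewrite lagrangian_conjugate_pinfty // leNye.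
have havgNy : (- conjugate h (bpart avg) != -oo)%E.
  by case: (conjugate h _) havg.
case fE : (f (xpart c')) (fNy (xpart c')) => [phi| |] // _; last first.
  rewrite {2}/lagrangian fE.
  by case: (g _) (gNy (apart c')) => [r| |] // _;
    case: (conjugate h _) havgNy => [s| |] // _; rewrite leey.
case gE : (g (apart c')) (gNy (apart c')) => [gamma| |] // _; last first.
  rewrite {2}/lagrangian fE gE.
  by case: (conjugate h _) havgNy => [s| |] // _; rewrite leey.
apply: (le_trans (lagrangian_le_fin A B _ favg gavg hE)).
apply: (le_trans _ (leeD (lexx _) (lagrangian_ge_fin A B _ fE gE havg))).
rewrite -EFinD lee_fin avgx avga avgb avgp.
rewrite (coupling_averagel _ _ (fun i => xpart (ct i)) (fun i => apart (ct i))).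
rewrite (coupling_averager _ _ _ _ (fun i => bpart (ct i))
  (fun i => ppart (ct i))).
(* The function [ell] is inferred from [pd_op_monotone_gap] as the Lagrangian difference; the
   telescoped sum is then divided by k + 1. *)
have := ppa_sum_le k.+1 adm ppa (fun c v Tv => pd_op_monotone_gap Tv fE gE hE).
rewrite !(sumrB, big_split) /= !sumr_const !card_ord.
have k0 : 0 < k.+1%:R^-1 :> R by rewrite invr_gt0 ltr0n.
rewrite -(ler_pM2l k0) invfM mulrA /F /G /H.
have const (r : R) : k.+1%:R^-1 * (r *+ k.+1) = r.
  by rewrite -[r *+ _]mulr_natl mulKf ?pnatr_eq0.
rewrite !(mulrDr, mulrN) !const [2^-1 * _]mulrC.
by rewrite lerBlDr.
Qed.

(** The monotonicity bound with v = 0 is the saddle inequality; the strict bounds serve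
    [ereal_sup_sub_inf_ge0]. *)
Lemma zer_lagrangian_le cs c : proper_lsc_convex f -> proper_lsc_convex g ->
  proper_lsc_convex h -> zer (pd_op f g h A B) cs ->
  [/\ (lagrangian f g h A B (xpart cs) (apart cs) (bpart c) (ppart c) < +oo)%E,
   (-oo < lagrangian f g h A B (xpart c) (apart c) (bpart cs) (ppart cs))%E &
   (lagrangian f g h A B (xpart cs) (apart cs) (bpart c) (ppart c)
   <= lagrangian f g h A B (xpart c) (apart c) (bpart cs) (ppart cs))%E].
Proof.
move=> [[fNy _] _ _] [[gNy _] _ _] [hp _ _] zcs.
have [/fineK fsE /fineK gsE /fineK hsE] := pd_op_fin zcs.
have hNy := conjugate_gtNy (bpart c) hp.
split.
- rewrite /lagrangian -fsE -gsE; case: (conjugate h _) hNy => // r _.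
  by rewrite -?EFinD -?EFinB ltry.
- rewrite /lagrangian -hsE; case: (f _) (fNy (xpart c)) => // [r|] _;
  by case: (g _) (gNy (apart c)) => // *; rewrite -?EFinD -?EFinB ?ltNyr.
case hE : (conjugate h (bpart c)) hNy => [r| |] // _;
  last by rewrite lagrangian_conjugate_pinfty // leNye.
case fE : (f (xpart c)) (fNy (xpart c)) => [s| |] // _; last first.
  rewrite {2}/lagrangian fE -hsE.
  by case: (g _) (gNy (apart c)) => [t| |] // _; rewrite leey.
case gE : (g (apart c)) (gNy (apart c)) => [t| |] // _; last first.
  by rewrite {2}/lagrangian fE gE -hsE leey.
have := pd_op_monotone_gap zcs fE gE hE; rewrite inner0l subr_le0.
rewrite -lee_fin => le0.
have hs_le : (conjugate h (bpart cs)
    <= (fine (conjugate h (bpart cs)))%:E)%E by rewrite hsE.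
apply: le_trans (lagrangian_ge_fin A B _ fE gE hs_le).
by apply: le_trans le0; apply: lagrangian_le_fin; rewrite ?fsE ?gsE.
Qed.

End Rate.

Theorem corollary4 (R : realType) (N M1 M2 : nat)
    (f : 'cV[R]_N -> \bar R) (g : 'cV[R]_M1 -> \bar R) (h : 'cV[R]_M2 -> \bar R)
    (hf : proper_lsc_convex f) (hg : proper_lsc_convex g)
    (hh : proper_lsc_convex h)
    (A : 'M[R]_(M1, N)) (B : 'M[R]_(M2, N))
    (M : 'M[R]_N) (Omega Theta : 'M[R]_M1) (Gamma : 'M[R]_M2)
    (M_sym : M^T = M) (Omega_sym : Omega^T = Omega)
    (Theta_sym : Theta^T = Theta) (Gamma_sym : Gamma^T = Gamma)
    (Theta_inv : Theta \in unitmx) (Gamma_inv : Gamma \in unitmx)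
    (s : mix_scheme)
    (hs : mix_condition s A B M Omega Theta Gamma)
    (c ct : nat -> 'cV[R]_(N + (M1 + (M2 + M1))))
    (hc : generalized_ppa (pd_op f g h A B)
            (mix_Q s A B M Omega Theta Gamma) (mix_M s A B Theta Gamma) c ct)
    (B1 : set 'cV[R]_N) (B2 : set 'cV[R]_M1)
    (B3 : set 'cV[R]_M2) (B4 : set 'cV[R]_M1)
    (hB : bounded_set (box B1 B2 B3 B4))
    (k : nat) (hk : (1 <= k)%N) :
  let avg := k%:R^-1 *: \sum_(i < k) ct i in
  (gap f g h A B B1 B2 B3 B4 avg
     <= ((2 * k%:R)^-1)%R%:E
        * ereal_sup [set (norm2 (mix_S s A B M Omega Theta Gamma) (c 0%N - c')%R)%:E
                    | c' in box B1 B2 B3 B4])%E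
  /\
  ((exists2 cstar, box B1 B2 B3 B4 cstar & zer (pd_op f g h A B) cstar) ->
   (0 <= gap f g h A B B1 B2 B3 B4 avg)%E).
Proof.
set S := mix_S s A B M Omega Theta Gamma.
have adm := mix_admissible M_sym Omega_sym Theta_inv Gamma_inv hs.
case: k hk => // k _ avg; split.
  apply: ereal_sup_sub_inf_le => _ _ [[b p] /= [B3b B4p] <-]
    [[x a] /= [B1x B2a] <-].
  (* The test point stacks (b, p) from the supremum with (x, a) from the infimum, hence lies in the
     box. *)
  pose c' := vec4 x a b p.
  have := lagrangian_sub_average_le c' hf hg hh adm hc (erefl avg).
  rewrite /= !parts_vec4 => /le_trans; apply; apply: leeD => //.
  rewrite EFinM; apply: lee_wpmul2l.
    by rewrite lee_fin invr_ge0 mulr_ge0.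
  by apply: ereal_sup_ubound; exists c' => //; rewrite /box /= !parts_vec4.
move=> [cs [B1s B2s B3s B4s] zcs].
have [Vy Uy VU] := zer_lagrangian_le avg hf hg hh zcs.
(* The saddle point supplies both witnesses: its dual part in the supremum, its primal part in the
   infimum. *)
apply: ereal_sup_sub_inf_ge0 Uy Vy VU.
  by exists (bpart cs, ppart cs).
by exists (xpart cs, apart cs).
Qed.
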